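(* Let $k'\in[0,1]$ and $k$ be parameters associated with $V_h$ and $L_h$, and let the RK method be $p$th order accurate, $p\ge1$. Suppose: 1. There exists $\lambda>0$ such that $\|R_s(\tau L_h)\|\le1+\mu_h\tau$ for all $\tau\le\lambda h^q$. 2. There exists a linear operator $\Pi$ with range in $V_h$ such that for every sufficiently smooth $w$, $$\|w-\Pi w\|\le C_{\rm T}h^{k+1},\qquad \langle(L-L_h\Pi)w,v_h\rangle\le C_{\rm S}h^{k+k'}\|v_h\|\quad\text{for all }v_h\in V_h,$$ where $C_{\rm S}$ and $C_{\rm T}$ are constants (independent of $h$) depending on the Sobolev norm of $w$. Then, when $u$ is sufficiently smooth, for $\tau\le \lambda h^q$ and all $n\ge0$, $$\|u(t^n)-u_h^n\|\le e^{\mu_ht^n}\|\Pi u(0)-u_h^0\|+C_{\rm E}\big(\sigma(\mu_h,t^n)+1\big)\big(h^{k+k'}+\tau^p\big),$$ where $C_{\rm E}$ is a constant (independent of $h$, $\tau$, $n$) depending on $\{\alpha_i\}_{i=0}^s$ and the Sobolev norm of $u$.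
   Context: Setting. $\Omega\subset\mathbb{R}^d$ and $V=L^2(\Omega;\mathbb{R}^m)$ with inner product $\langle\cdot,\cdot\rangle$ and norm $\|\cdot\|$. $L=\sum_{|\alpha|\le q}a_\alpha(x)D^\alpha$ is a linear differential operator of order $q$ in $x$. $u:\Omega\times[0,\infty)\to\mathbb{R}^m$ satisfies $\partial_tu=Lu$; $u(t)=u(\cdot,t)\in V$. For each mesh size $0<h\le1$, $V_h\subset V$ is a finite-dimensional subspace and $L_h:V_h\to V_h$ is linear, with operator norm induced by $\|\cdot\|$. For real constants $\alpha_0,\dots,\alpha_s$, $R_s(\tau L_h)=\sum_{i=0}^s\alpha_i(\tau L_h)^i$, and the fully discrete solution is $u_h^{n+1}=R_s(\tau L_h)u_h^n$ with given $u_h^0\in V_h$, $t^n=n\tau$. Standing conventions: $\tau\le1$ and $\tau\|L_h\|$ is bounded by a constant less than $1$. $p$th order accuracy means $\alpha_i=1/i!$ for $0\le i\le p$ and $\alpha_{p+1}\ne1/(p+1)!$ (with $\alpha_i=0$ for $i>s$). $\mu_h\ge0$ is a constant. For $a\ge0$: $\sigma(a,t)=(e^{at}-1)/a$ if $a>0$, $\sigma(0,t)=t$. ''$u$ sufficiently smooth'' means: $\partial_t^iu$, $L^iu$ ($1\le i\le p+1$) and $\Pi\partial_t^iu(\cdot,t)$ ($0\le i\le p+1$) are well-defined and bounded, $\partial_t^iu=L^iu$ for $1\le i\le p+1$, the functions $L^iu(t)$, $0\le i\le p+1$, are sufficiently smooth in $x$ for condition 2 to apply to them, with the relevant Sobolev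 norms bounded uniformly in $t$ (and satisfy the boundary conditions of the problem, if any). $\Pi$ acts in the space variable and commutes with differentiation and integration in $t$ of these functions. *)

(* Defs.v *)
From HB Require Import structures.
From mathcomp Require Import all_boot all_order all_algebra.
From mathcomp Require Import all_classical all_reals all_analysis.
From mathcomp Require Import lra.
Set Implicit Arguments.
Unset Strict Implicit.
Unset Printing Implicit Defensive.
Import Order.TTheory GRing.Theory Num.Theory.
Export numFieldNormedType.Exports.
Local Open Scope classical_set_scope.
Local Open Scope ring_scope.

(* Lebesgue measure on the Borel sets of R^d: the d-fold product of the
   one-dimensional measure, built on d-tuples (product sigma-algebra) and
   transported to row vectors. *)
Section lebesgue_rV.
Variable R : realType.
Local Notation RR := (measurableTypeR R).

Definition image_measure d1 d2 (T1 : measurableType d1) (T2 : measurableType d2)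
    (mu : {measure set T1 -> \bar R}) (f : T1 -> T2)
    (mf : measurable_fun setT f) : {measure set T2 -> \bar R} :=
  measure_function_pushforward__canonical__measure_function_Measure mu mf.

Definition cons_pair (n : nat) (z : n.-tuple RR * RR) : n.+1.-tuple RR :=
  [tuple of z.2 :: z.1].

Lemma measurable_cons_pair n : measurable_fun setT (@cons_pair n).
Proof. exact: measurable_cons. Qed.

Fixpoint lebesgue_tuple (n : nat) : {measure set (n.-tuple RR) -> \bar R} :=
  match n with
  | 0 => \d_([tuple] : 0.-tuple RR)
  | n'.+1 => image_measure ((lebesgue_tuple n') \x (@lebesgue_measure R))%E
                           (@measurable_cons_pair n')
  end.

Definition borel_rV (d : nat) := g_sigma_algebraType (@open 'rV[R]_d).

Let dist_lt_double (c x y k e : R) : x - k < c -> c < x + k ->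
  c - k < y -> y < c + k -> k < e / 2 -> `|x - y| < e.
Proof. by move=> *; rewrite ltr_norml; apply/andP; split; lra. Qed.

Definition row_of_tuple (d : nat) (t : d.-tuple RR) : borel_rV d :=
  \row_i tnth t i.

Lemma measurable_row_of_tuple d : measurable_fun setT (@row_of_tuple d).
Proof.
apply: (measurability (@open 'rV[R]_d : set (set (borel_rV d)))) => //.
move=> _ [U oU <-]; rewrite setTI.
pose Q := ({ffun 'I_d -> rat} * nat)%type.
pose box (q : Q) : set (d.-tuple RR) :=
  \bigcap_(i : 'I_d) ((fun t => tnth t i) @^-1`
    `](ratr (q.1 i) - q.2.+1%:R^-1 : R), (ratr (q.1 i) + q.2.+1%:R^-1 : R)[).
pose P (q : Q) := box q `<=` (@row_of_tuple d) @^-1` U.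
have mbox q : measurable (box q).
  apply: fin_bigcap_measurable; first exact: finite_finset.
  move=> i _; rewrite -[X in measurable X]setTI.
  by apply: measurable_tnth => //; exact: measurable_itv.
suff -> : (@row_of_tuple d) @^-1` U =
    \bigcup_n (if unpickle n is Some q then
                 if `[< P q >] then box q else set0 else set0).
  apply: bigcupT_measurable => n; case: unpickle => [q|//].
  by case: ifP.
apply/seteqP; split => [t /= Ut|t [n _]]; last first.
  by case: unpickle => [q|//]; case: asboolP => // Pq /Pq.
have /nbhs_ballP[e /= e0 eU] : nbhs (row_of_tuple t : 'rV[R]_d) U.
  exact: open_nbhs_nbhs.
have [k ke] : exists k, k.+1%:R^-1 < e / 2.
  have [k _ /(_ k (leqnn k))] := near_infty_natSinv_lt (PosNum (divr_gt0 e0 (ltr0n R 2))).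
  by exists k.
have k0 : 0 < k.+1%:R^-1 :> R by rewrite invr_gt0 ltr0n.
have /choice[c cP] : forall i : 'I_d, exists c : rat,
    ratr c \in `](tnth t i - k.+1%:R^-1 : R), (tnth t i + k.+1%:R^-1 : R)[.
  by move=> i; apply: rat_in_itvoo; rewrite ltrBlDr -addrA ltrDl addr_gt0.
exists (pickle ([ffun i => c i], k) : nat) => //=.
rewrite pickleK asboolT.
  move=> i _ /=; rewrite ffunE.
  have := cP i; rewrite !in_itv /=.
  by move=> /andP[xc cx]; rewrite ltrBlDr cx -ltrBlDr xc.
move=> s bs; apply: eU; split=> // i j.
have {i}-> : i = ord0 by rewrite (ord1 i).
have := bs j Logic.I; have := cP j; rewrite /ball /= ffunE !in_itv /= !mxE.
by move=> /andP[xc cx] /andP[cy yc]; exact: dist_lt_double xc cx cy yc ke.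
Qed.

Definition lebesgue_rV (d : nat) : {measure set (borel_rV d) -> \bar R} :=
  image_measure (lebesgue_tuple d) (@measurable_row_of_tuple d).

End lebesgue_rV.

(* L^2(Omega; R^m).  Its elements are represented by functions on R^d, of which
   only the values on Omega matter; equality in the space is equality almost
   everywhere on Omega, written [f = g %[ae lebesgue_rV R d in Omega]]. *)
Section L2.
Context {R : realType} {d m : nat}.
Variable Omega : set 'rV[R]_d.
Local Notation fn := ('rV[R]_d -> 'cV[R]_m).
Local Notation leb := (lebesgue_rV R d).

Definition L2 : set fn := [set f : fn | forall j : 'I_m,
  measurable_fun (Omega : set (borel_rV R d)) (fun x : borel_rV R d => f (x : 'rV[R]_d) j 0) /\
  (\int[leb]_(x in Omega) ((f x j 0) ^+ 2)%:E < +oo)%E].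

Definition inner (f g : fn) : R :=
  \int[leb]_(x in Omega) (\sum_(j < m) f x j 0 * g x j 0).

Definition l2norm (f : fn) : R := Num.sqrt (inner f f).

Definition subspace (W : set fn) : Prop :=
  [/\ W `<=` L2, W 0 & forall (c : R) f g, W f -> W g -> W (c *: f + g)].

Definition finite_dim_subspace (W : set fn) : Prop :=
  subspace W /\ exists (N : nat) (b : 'I_N -> fn), (forall i, W (b i)) /\
    forall f, W f -> exists c : 'I_N -> R,
      f = \sum_(i < N) c i *: b i %[ae leb in Omega].

(* A is a linear map on the subspace W, well defined on classes modulo
   equality almost everywhere *)
Definition linear_on (W : set fn) (A : fn -> fn) : Prop :=
  [/\ subspace W,
      forall f g, W f -> W g ->
        f = g %[ae leb in Omega] -> A f = A g %[ae leb in Omega]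
    & forall (c : R) f g, W f -> W g ->
        A (c *: f + g) = c *: A f + A g %[ae leb in Omega]].

(* operator norm on W induced by l2norm; extended-real valued, so that no
   boundedness is presupposed *)
Definition opnorm (W : set fn) (A : fn -> fn) : \bar R :=
  ereal_sup [set (l2norm (A v))%:E | v in [set v | W v /\ l2norm v <= 1]].

End L2.

Section space_derivatives.
Context {R : realType} {d m : nat}.
Variable Omega : set 'rV[R]_d.
Local Notation fn := ('rV[R]_d -> 'cV[R]_m).

Definition partial (i : 'I_d) (f : fn) : fn := fun x => 'D_(delta_mx 0 i) f x.

Definition partials (is_ : seq 'I_d) (f : fn) : fn := foldr partial f is_.

(* multi-indices with entries at most n; those with [mi_order al <= n] are
   exactly the multi-indices of order at most n *)
Definition multi_index (n : nat) := {ffun 'I_d -> 'I_n.+1}.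

Definition mi_order n (al : multi_index n) : nat := (\sum_(i < d) al i)%N.

Definition Dmi n (al : multi_index n) (f : fn) : fn :=
  partials (flatten [seq nseq (al i) i | i <- enum 'I_d]) f.

Definition class_C (r : nat) (f : fn) : Prop :=
  (forall is_, (size is_ <= r)%N ->
     forall x, Omega x -> {for x, continuous (partials is_ f)}) /\
  (forall is_ i, (size is_ < r)%N ->
     forall x, Omega x -> derivable (partials is_ f) x (delta_mx 0 i)).

Definition sobolev_norm (r : nat) (f : fn) : R :=
  Num.sqrt (\sum_(al : multi_index r | (mi_order al <= r)%N)
              l2norm Omega (Dmi al f) ^+ 2).

Definition diff_op (q : nat) (a : multi_index q -> 'rV[R]_d -> 'M[R]_m)
    (f : fn) : fn := fun x =>
  \sum_(al : multi_index q | (mi_order al <= q)%N) a al x *m Dmi al f x.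

Definition exact_order (q : nat)
    (a : multi_index q -> 'rV[R]_d -> 'M[R]_m) : Prop :=
  exists (al : multi_index q) (x : 'rV[R]_d),
    [/\ mi_order al = q, Omega x & a al x <> 0].

(* the functions to which the approximation and consistency estimates apply:
   class C^r with finite H^r norm, image under the operator in L^2, and the
   boundary conditions bc *)
Definition smooth_fn (q r : nat) (a : multi_index q -> 'rV[R]_d -> 'M[R]_m)
    (bc : set fn) (w : fn) : Prop :=
  [/\ class_C r w,
      forall al : multi_index r, (mi_order al <= r)%N -> L2 Omega (Dmi al w),
      L2 Omega (diff_op a w)
    & bc w].

End space_derivatives.

Arguments multi_index : clear implicits.

Section time.
Context {R : realType} {d m : nat}.

(* derivatives on [0, +oo), hence one-sided at 0 *)
Definition time_quotient (f : R -> 'cV[R]_m) (t s : R) : 'cV[R]_m :=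
  (s - t)^-1 *: (f s - f t).

Definition time_derivable (f : R -> 'cV[R]_m) (t : R) : Prop :=
  cvg (time_quotient f t s @[s --> within [set s | 0 <= s] t^']).

Definition time_derivative (f : R -> 'cV[R]_m) (t : R) : 'cV[R]_m :=
  lim (time_quotient f t s @[s --> within [set s | 0 <= s] t^']).

Definition dt (i : nat) (u : 'rV[R]_d -> R -> 'cV[R]_m) :
    'rV[R]_d -> R -> 'cV[R]_m :=
  fun x => iter i time_derivative (u x).

Definition time_integral (a b : R) (u : 'rV[R]_d -> R -> 'cV[R]_m) :
    'rV[R]_d -> 'cV[R]_m :=
  fun x => \col_j \int[lebesgue_measure]_(s in `[a, b]) u x s j 0.

End time.

Section scheme.
Context {R : realType} {d m : nat}.
Variable Omega : set 'rV[R]_d.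
Local Notation fn := ('rV[R]_d -> 'cV[R]_m).

(* R_s(tau L_h) *)
Definition rk_op (s : nat) (alpha : nat -> R) (tau : R) (Lh : fn -> fn)
    (v : fn) : fn :=
  \sum_(i < s.+1) alpha i *: iter i (fun w => tau *: Lh w) v.

Definition rk_accurate (s p : nat) (alpha : nat -> R) : Prop :=
  [/\ forall i, (s < i)%N -> alpha i = 0,
      forall i, (i <= p)%N -> alpha i = (i`!)%:R^-1
    & alpha p.+1 <> (p.+1`!)%:R^-1].

Definition discrete_solution (Vh : set fn) (Rh : fn -> fn) (uh : nat -> fn) :=
  (forall n, Vh (uh n)) /\
  (forall n, uh n.+1 = Rh (uh n) %[ae lebesgue_rV R d in Omega]).

(* sigma(a, t) = \int_0^t exp(a s) ds *)
Definition sigma (a t : R) : R := if a == 0 then t else (expR (a * t) - 1) / a.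

(* standing conventions on the time step, with time step restriction
   tau <= lambda h^q *)
Definition admissible (q : nat) (lambda c : R) (Vh : R -> set fn)
    (Lh : R -> fn -> fn) (h tau : R) : Prop :=
  [/\ 0 < h <= 1, 0 < tau <= 1,
      (tau%:E * opnorm Omega (Vh h) (Lh h) <= c%:E)%E
    & tau <= lambda * h ^+ q].

Definition rk_stable (q s : nat) (alpha : nat -> R) (lambda c : R)
    (Vh : R -> set fn) (Lh : R -> fn -> fn) (mu : R -> R) : Prop :=
  forall h tau, admissible q lambda c Vh Lh h tau ->
    (opnorm Omega (Vh h) (rk_op s alpha tau (Lh h)) <= (1 + mu h * tau)%:E)%E.

(* Pi h is a linear operator defined on the subspace DPi h of L^2 *)
Record consistent (q r : nat) (a : multi_index d q -> 'rV[R]_d -> 'M[R]_m)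
    (bc : set fn) (k k' : R) (CT CS : R -> R) (Vh : R -> set fn)
    (Lh : R -> fn -> fn) (DPi : R -> set fn) (Pi : R -> fn -> fn) : Prop := {
  Pi_linear : forall h, 0 < h <= 1 -> linear_on Omega (DPi h) (Pi h) ;
  Pi_range : forall h f, 0 < h <= 1 -> DPi h f -> Vh h (Pi h f) ;
  Pi_smooth : forall h w, 0 < h <= 1 -> smooth_fn Omega r a bc w -> DPi h w ;
  approximation : forall h w, 0 < h <= 1 -> smooth_fn Omega r a bc w ->
    l2norm Omega (w - Pi h w) <= CT (sobolev_norm Omega r w) * h `^ (k + 1) ;
  consistency : forall h w, 0 < h <= 1 -> smooth_fn Omega r a bc w ->
    forall v, Vh h v ->
      inner Omega (diff_op a w - Lh h (Pi h w)) v <=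
        CS (sobolev_norm Omega r w) * h `^ (k + k') * l2norm Omega v
}.

Record solution (q : nat) (a : multi_index d q -> 'rV[R]_d -> 'M[R]_m)
    (u : 'rV[R]_d -> R -> 'cV[R]_m) : Prop := {
  solution_L2 : forall t, 0 <= t -> L2 Omega (u ^~ t) ;
  solution_pde : forall x t, Omega x -> 0 <= t ->
    time_derivable (u x) t /\ dt 1 u x t = diff_op a (u ^~ t) x
}.

(* "u is sufficiently smooth"; M bounds the relevant Sobolev norms.
   The derivative in t of Pi h (dt i u) is taken in the L^2 norm, and its
   integral in t is tested against the finite-dimensional space Vh h. *)
Record smooth_solution (q r p : nat)
    (a : multi_index d q -> 'rV[R]_d -> 'M[R]_m) (bc : set fn)
    (Vh : R -> set fn) (DPi : R -> set fn) (Pi : R -> fn -> fn) (M : R)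
    (u : 'rV[R]_d -> R -> 'cV[R]_m) : Prop := {
  dt_exists : forall i x t, (i <= p)%N -> Omega x -> 0 <= t ->
    time_derivable (dt i u x) t ;
  dt_bounded : exists B : R, forall i t, (1 <= i <= p.+1)%N -> 0 <= t ->
    L2 Omega (dt i u ^~ t) /\ l2norm Omega (dt i u ^~ t) <= B ;
  L_bounded : exists B : R, forall i t, (1 <= i <= p.+1)%N -> 0 <= t ->
    L2 Omega (iter i (diff_op a) (u ^~ t)) /\
    l2norm Omega (iter i (diff_op a) (u ^~ t)) <= B ;
  dt_L : forall i x t, (1 <= i <= p.+1)%N -> Omega x -> 0 <= t ->
    dt i u x t = iter i (diff_op a) (u ^~ t) x ;
  L_smooth : forall i t, (i <= p.+1)%N -> 0 <= t ->
    smooth_fn Omega r a bc (iter i (diff_op a) (u ^~ t)) ;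
  L_sobolev : forall i t, (i <= p.+1)%N -> 0 <= t ->
    sobolev_norm Omega r (iter i (diff_op a) (u ^~ t)) <= M ;
  Pi_dt_bounded : forall h, 0 < h <= 1 ->
    exists B : R, forall i t, (i <= p.+1)%N -> 0 <= t ->
      DPi h (dt i u ^~ t) /\ l2norm Omega (Pi h (dt i u ^~ t)) <= B ;
  Pi_derivative : forall h i t, 0 < h <= 1 -> (i <= p)%N -> 0 <= t ->
    l2norm Omega ((s - t)^-1 *: (Pi h (dt i u ^~ s) - Pi h (dt i u ^~ t))
                  - Pi h (dt i.+1 u ^~ t))
      @[s --> within [set s | 0 <= s] t^'] --> (0 : R) ;
  Pi_integral : forall h i t1 t2, 0 < h <= 1 -> (i <= p.+1)%N ->
    0 <= t1 <= t2 ->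
    DPi h (time_integral t1 t2 (dt i u)) /\
    forall v, Vh h v ->
      inner Omega (Pi h (time_integral t1 t2 (dt i u))) v =
      \int[lebesgue_measure]_(s in `[t1, t2]) inner Omega (Pi h (dt i u ^~ s)) v
}.

End scheme.

(* Main.v *)
Require Import Defs.
From mathcomp Require Import all_boot all_order all_algebra.
From mathcomp Require Import all_classical all_reals all_analysis.
From mathcomp Require Import measurable_realfun lra ring.
Import Order.TTheory GRing.Theory Num.Theory.
Local Open Scope classical_set_scope.
Local Open Scope ring_scope.

(** Why the estimate holds.  Write [P_i(t)] for the projection by [Pi h] of the
   i-th time derivative of [u], which on [Omega] is the i-th iterate of the
   differential operator applied to [u].  The error splits into
   [u - P_0], controlled by the approximation property, and
   [e_n = P_0(t^n) - u_h^n], which lives in [Vh h].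

   The sequence [e_n] obeys [|e_(n+1)| <= (1 + mu tau) |e_n| + local error]:
   the factor is the stability hypothesis applied to the linear operator
   [R_s(tau L_h)], and the local error is [P_0(t + tau) - R_s(tau L_h) P_0(t)].
   A discrete Gronwall argument ([discrete_gronwall]) then produces the
   exponential and [sigma].

   The local error is bounded in [rk_local_error] by comparing both terms with
   [sum_(i <= p) tau^i / i! P_i(t)].
   - Taylor: the distance from [P_0(t + tau)] is at most
     [tau^(p+1) sup |P_(p+1)|] ([taylor_seminorm]).  As the time derivatives are
     taken in the norm, pairing with a fixed vector gives scalar functions, and
     taking that vector to be the remainder itself turns the scalar bound
     ([taylor_remainder_le]) into a norm bound.
   - Consistency: [L_h P_i] and [P_(i+1)] differ by [O(h^(k+k'))]
     ([intertwining_error]).  Put [g_i = tau^i P_i]: then [tau L_h g_i] is within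
     [O(tau h^(k+k'))] of [g_(i+1)], and because [tau L_h] does not increase the
     norm these defects add up without amplification, so that
     [(tau L_h)^i g_0] stays close to [g_i] for [i <= p + 1] ([iter_chain]).  The
     higher powers in the scheme are no larger than the power [p + 1], of size
     [tau^(p+1)] ([op_poly_chain]).  No inverse power of [h] appears.

   Finally [P_(p+1)] is bounded through the approximation property by the
   Sobolev norm rather than by a bound depending on [h], which makes the
   constant depend on [M] and on the coefficients alone.

   Elements of L^2 are functions, equality being almost everywhere, so all the
   norm estimates are made for a seminorm coming from a semidefinite form, with
   equalities replaced by differences of seminorm zero. *)

Set Implicit Arguments.
Unset Strict Implicit.
Unset Printing Implicit Defensive.

(** * Spaces with a semidefinite inner product *)

Definition linear_subspace (R : realType) (V : lmodType R) (W : set V) : Prop :=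
  W 0 /\ forall (c : R) f g, W f -> W g -> W (c *: f + g).

Section linear_subspace_theory.
Variables (R : realType) (V : lmodType R) (W : set V).
Hypothesis WL : linear_subspace W.

Lemma linear_subspaceZ (c : R) f : W f -> W (c *: f).
Proof. by move=> Wf; rewrite -[_ *: _]addr0; apply: WL.2 => //; exact: WL.1. Qed.

Lemma linear_subspaceD f g : W f -> W g -> W (f + g).
Proof. by move=> Wf Wg; rewrite -[f]scale1r; exact: WL.2. Qed.

Lemma linear_subspaceN f : W f -> W (- f).
Proof. by rewrite -scaleN1r; exact: linear_subspaceZ. Qed.

Lemma linear_subspaceB f g : W f -> W g -> W (f - g).
Proof. by move=> Wf Wg; apply: linear_subspaceD => //; exact: linear_subspaceN. Qed.

Lemma linear_subspace_sum n (F : 'I_n -> V) :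
  (forall i, W (F i)) -> W (\sum_(i < n) F i).
Proof.
move=> WF; elim/big_ind: _ => //; first exact: WL.1.
exact: linear_subspaceD.
Qed.

End linear_subspace_theory.

(** The form is bilinear on [X] only: the L^2 pairing of functions outside L^2
   has no algebraic properties. *)
Record semi_inner (R : realType) (V : lmodType R) (X : set V)
    (ip : V -> V -> R) : Prop := {
  semi_inner_closed : linear_subspace X ;
  semi_innerC : forall f g, ip f g = ip g f ;
  semi_inner_linear : forall c f g h, X f -> X g -> X h ->
    ip (c *: f + g) h = c * ip f h + ip g h ;
  semi_inner_ge0 : forall f, 0 <= ip f f }.

Section seminorm.
Variables (R : realType) (V : lmodType R) (X : set V) (ip : V -> V -> R).
Hypothesis ipX : semi_inner X ip.

Local Notation N f := (Num.sqrt (ip f f)).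
Let XL := semi_inner_closed ipX.

Lemma ipDl f g h : X f -> X g -> X h -> ip (f + g) h = ip f h + ip g h.
Proof.
by move=> Xf Xg Xh; rewrite -[f]scale1r (semi_inner_linear ipX)// !(mul1r, scale1r).
Qed.

Lemma ip0l h : X h -> ip 0 h = 0.
Proof.
move=> Xh; have := ipDl XL.1 XL.1 Xh.
by rewrite addr0 => /eqP; rewrite -subr_eq subrr => /eqP.
Qed.

Lemma ipZl c f h : X f -> X h -> ip (c *: f) h = c * ip f h.
Proof.
move=> Xf Xh; rewrite -[_ *: _]addr0 (semi_inner_linear ipX)//; last exact: XL.1.
by rewrite ip0l// addr0.
Qed.

Lemma ipDr f g h : X f -> X g -> X h -> ip h (f + g) = ip h f + ip h g.
Proof. by move=> *; rewrite !(semi_innerC ipX h) ipDl. Qed.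

Lemma ipZr c f h : X f -> X h -> ip h (c *: f) = c * ip h f.
Proof. by move=> *; rewrite !(semi_innerC ipX h) ipZl. Qed.

Lemma ipBl f g h : X f -> X g -> X h -> ip (f - g) h = ip f h - ip g h.
Proof.
move=> Xf Xg Xh; rewrite ipDl//; last exact: linear_subspaceN.
by rewrite -scaleN1r ipZl// mulN1r.
Qed.

Lemma ip_suml n (F : 'I_n -> V) h : (forall i, X (F i)) -> X h ->
  ip (\sum_(i < n) F i) h = \sum_(i < n) ip (F i) h.
Proof.
move=> XF Xh; elim: n F XF => [|n IH] F XF; first by rewrite !big_ord0 ip0l.
by rewrite !big_ord_recl ipDl ?IH//; exact: linear_subspace_sum.
Qed.

Lemma normX f : N f ^+ 2 = ip f f.
Proof. by rewrite sqr_sqrtr// (semi_inner_ge0 ipX). Qed.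

(** Cauchy-Schwarz holds without definiteness: if [ip f f = 0], the nonnegative
   affine function [2 s (ip f g) + ip g g] of [s] must be constant. *)
Lemma cauchy_schwarz f g : X f -> X g -> `|ip f g| <= N f * N g.
Proof.
move=> Xf Xg.
have pos s : 0 <= s ^+ 2 * ip f f + 2 * s * ip f g + ip g g.
  have := semi_inner_ge0 ipX (s *: f + g).
  have Xsf := linear_subspaceZ XL s Xf.
  rewrite (semi_inner_linear ipX)//; last exact: linear_subspaceD.
  rewrite !ipDr// !ipZr// (semi_innerC ipX g f) => h; nra.
rewrite -ler_sqr ?nnegrE ?mulr_ge0 ?sqrtr_ge0//.
rewrite exprMn !normX real_normK ?num_real//.
move: pos (semi_inner_ge0 ipX f).
move: (ip f f) (ip f g) (ip g g) => A B C pos; rewrite le_eqVlt => /predU1P[A0|A0].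
  rewrite -A0 in pos *; rewrite mul0r; have [->|B0] := eqVneq B 0.
    by rewrite expr0n.
  (* at this point the affine function takes the value -1 *)
  have := pos (- (C + 1) / (2 * B)).
  have -> : 2 * (- (C + 1) / (2 * B)) * B = - (C + 1) by field.
  by rewrite mulr0 add0r => ?; exfalso; lra.
(* the minimum of the quadratic function *)
have := pos (- B / A).
have -> : (- B / A) ^+ 2 * A + 2 * (- B / A) * B + C = (A * C - B ^+ 2) / A.
  by field; rewrite gt_eqF.
by rewrite pmulr_lge0 ?invr_gt0// subr_ge0.
Qed.

Lemma normZ c f : X f -> N (c *: f) = `|c| * N f.
Proof.
move=> Xf; rewrite ipZl ?ipZr//; last exact: linear_subspaceZ.
by rewrite mulrA -expr2 sqrtrM ?sqr_ge0// sqrtr_sqr.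
Qed.

Lemma norm0 : N 0 = 0.
Proof. by rewrite ip0l ?sqrtr0//; exact: XL.1. Qed.

Lemma normN f : X f -> N (- f) = N f.
Proof. by move=> Xf; rewrite -scaleN1r normZ// normrN normr1 mul1r. Qed.

Lemma normD f g : X f -> X g -> N (f + g) <= N f + N g.
Proof.
move=> Xf Xg; have Xfg := linear_subspaceD XL Xf Xg.
rewrite -ler_sqr ?nnegrE ?addr_ge0 ?sqrtr_ge0// sqrrD !normX.
rewrite ipDl// !ipDr// (semi_innerC ipX g f).
have := cauchy_schwarz Xf Xg; rewrite ler_norml => /andP[_]; lra.
Qed.

Lemma norm_sum n (F : 'I_n -> V) : (forall i, X (F i)) ->
  N (\sum_(i < n) F i) <= \sum_(i < n) N (F i).
Proof.
elim: n F => [|n IH] F XF; first by rewrite !big_ord0 norm0.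
rewrite !big_ord_recl; apply: le_trans (normD (XF _) _) _.
  exact: linear_subspace_sum.
by rewrite lerD2l IH.
Qed.

Lemma normB f g : X f -> X g -> N (f - g) = N (g - f).
Proof. by move=> Xf Xg; rewrite -opprB normN//; exact: linear_subspaceB. Qed.

Lemma norm_trans g f h : X f -> X g -> X h -> N (f - h) <= N (f - g) + N (g - h).
Proof.
move=> Xf Xg Xh; rewrite -(subrKA g f (- h)).
by apply: normD; exact: linear_subspaceB.
Qed.

Lemma norm_sub_le f g : X f -> X g -> N f <= N (f - g) + N g.
Proof.
by move=> Xf Xg; have := norm_trans Xf Xg XL.1; rewrite !subr0.
Qed.

Lemma norm_null f g : X f -> X g -> N (f - g) = 0 -> N f = N g.
Proof.
move=> Xf Xg fg; apply/eqP; rewrite eq_le.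
have := norm_sub_le Xf Xg; have := norm_sub_le Xg Xf.
by rewrite (normB Xg Xf) fg !add0r => -> ->.
Qed.

(** How a bound on a pairing with all vectors becomes a bound on a norm: pair a
   vector with itself and cancel. *)
Lemma norm_le_dual f C : 0 <= C -> ip f f <= C * N f -> N f <= C.
Proof.
move=> C0; rewrite -[leLHS]normX expr2.
have := sqrtr_ge0 (ip f f); rewrite le_eqVlt => /predU1P[<-//|Nf].
by rewrite ler_pM2r.
Qed.

(** The pairing with [p - l] is the only consistency information available: it
   is tested against the error itself.  Here [w] is the exact image under the
   differential operator, [p] its projection, [l] the image under the discrete
   operator, and [l'] a representative of the class of [l]. *)
Lemma intertwining_error w p l l' a b :
  X w -> X p -> X l -> X l' -> 0 <= a -> 0 <= b ->
  N (w - p) <= a -> N (l' - l) = 0 ->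
  ip (w - l') (p - l) <= b * N (p - l) -> N (l - p) <= a + b.
Proof.
move=> Xw Xp Xl Xl' a0 b0 wp ll' wl'.
rewrite normB//; set z := p - l.
have Xz : X z by exact: linear_subspaceB.
apply: norm_le_dual; first exact: addr_ge0.
have zE : ip z z = ip (p - w) z + (ip (w - l') z + ip (l' - l) z).
  by rewrite {1}/z !ipBl//; ring.
have pwz : ip (p - w) z <= a * N z.
  apply: le_trans (ler_norm _) _.
  apply: le_trans (cauchy_schwarz (linear_subspaceB XL Xp Xw) Xz) _.
  by rewrite ler_wpM2r ?sqrtr_ge0// normB.
have llz : ip (l' - l) z <= 0.
  apply: le_trans (ler_norm _) _.
  apply: le_trans (cauchy_schwarz (linear_subspaceB XL Xl' Xl) Xz) _.
  by rewrite ll' mul0r.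
by rewrite [leLHS]zE mulrDl lerD// -[leRHS]addr0 lerD.
Qed.

End seminorm.

(** * Linear operators up to null vectors *)

Section operators.
Variables (R : realType) (V : lmodType R) (X : set V) (ip : V -> V -> R).
Hypothesis ipX : semi_inner X ip.
Variable W : set V.
Hypotheses (WL : linear_subspace W) (WX : W `<=` X).

Local Notation N f := (Num.sqrt (ip f f)).

(** The linearity that an operator on classes modulo null vectors gives to its
   representatives. *)
Definition seminorm_linear (A : V -> V) : Prop :=
  (forall f, W f -> W (A f)) /\
  forall (c : R) f g, W f -> W g -> N (A (c *: f + g) - (c *: A f + A g)) = 0.

Lemma seminorm_linear0 A : seminorm_linear A -> N (A 0) = 0.
Proof.
move=> [WA linA]; have X0 := WX (WA _ WL.1).
have := linA 1 0 0 WL.1 WL.1.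
by rewrite !scale1r addr0 opprD addrA subrr sub0r (normN ipX).
Qed.

Lemma seminorm_linearZ A c f : seminorm_linear A -> W f ->
  N (A (c *: f) - c *: A f) = 0.
Proof.
move=> lA Wf; have [WA linA] := lA.
have WAf := WA _ Wf; have WA0 := WA _ WL.1.
have Wcf := linear_subspaceZ WL c WAf.
have WAcf := WA _ (linear_subspaceZ WL c Wf).
apply/eqP; rewrite eq_le sqrtr_ge0 andbT.
have WD := linear_subspaceD WL Wcf WA0.
apply: le_trans (norm_trans ipX (g := c *: A f + A 0) _ _ _) _; try exact: WX.
have := linA c f 0 Wf WL.1; rewrite addr0 => ->.
by rewrite addrAC subrr add0r add0r seminorm_linear0.
Qed.

Lemma seminorm_linearB A f g : seminorm_linear A -> W f -> W g ->
  N (A f - A g) = N (A (f - g)).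
Proof.
move=> lA Wf Wg; have [WA linA] := lA.
have WAf := WA _ Wf; have WAg := WA _ Wg.
have WAfg := WA _ (linear_subspaceB WL Wf Wg).
have Wfg := linear_subspaceB WL WAf WAg.
apply/esym/(norm_null ipX); try exact: WX.
have := linA (-1) g f Wg Wf.
by rewrite !scaleN1r ![- _ + _]addrC.
Qed.

(** In a seminorm the normalization of [v] is impossible when [N v = 0]; the
   vector [v / (N v + e)] always lies in the unit ball, and [e] tends to 0. *)
Lemma ball_bounded A C : seminorm_linear A ->
  (forall v, W v -> N v <= 1 -> N (A v) <= C) ->
  forall v, W v -> N (A v) <= C * N v.
Proof.
move=> lA bA v Wv; have [WA _] := lA.
have C0 : 0 <= C.
  apply: le_trans (sqrtr_ge0 _) (bA 0 WL.1 _).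
  by rewrite (norm0 ipX) ler01.
suff H e : 0 < e -> N (A v) <= C * (N v + e).
  apply/ler_addgt0Pr => e e0.
  have C10 : 0 < C + 1 by rewrite ltr_wpDl.
  apply: le_trans (H _ (divr_gt0 e0 C10)) _.
  rewrite mulrDr lerD2l mulrCA ger_pMr//.
  by rewrite ler_pdivrMr// mul1r lerDl ler01.
move=> e0; have Ne : 0 < N v + e by rewrite ltr_wpDl ?sqrtr_ge0.
pose c := (N v + e)^-1.
have c0 : 0 < c by rewrite invr_gt0.
have Wcv := linear_subspaceZ WL c Wv.
have := bA _ Wcv; rewrite (norm_null ipX _ _ (seminorm_linearZ c lA Wv)); last 2 first.
- exact/WX/WA.
- exact/WX/(linear_subspaceZ WL)/WA.
rewrite !(normZ ipX); [|exact: WX|exact/WX/WA].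
rewrite gtr0_norm// /c ![_^-1 * _]mulrC !ler_pdivrMr// mul1r lerDl; apply.
exact: ltW.
Qed.

Definition nonexpansive (A : V -> V) := forall v, W v -> N (A v) <= N v.

Lemma nonexpansiveB A f g : seminorm_linear A -> nonexpansive A ->
  W f -> W g -> N (A f - A g) <= N (f - g).
Proof.
move=> lA cA Wf Wg; rewrite seminorm_linearB//.
by apply: cA; exact: linear_subspaceB.
Qed.

Lemma iter_closed A i f : seminorm_linear A -> W f -> W (iter i A f).
Proof. by move=> [WA _] Wf; elim: i => //= i; exact: WA. Qed.

Lemma iter_nonexpansive A i : seminorm_linear A -> nonexpansive A ->
  nonexpansive (iter i A).
Proof.
move=> lA cA v Wv; elim: i => //= i; apply: le_trans.
by apply: cA; exact: iter_closed.
Qed.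

Lemma iter_linear A i : seminorm_linear A -> nonexpansive A ->
  seminorm_linear (iter i A).
Proof.
move=> lA cA; split=> [f|c f g Wf Wg]; first exact: iter_closed.
elim: i => [|i IH] /=; first by rewrite subrr (norm0 ipX).
have Wfi := iter_closed i lA Wf; have Wgi := iter_closed i lA Wg.
have Wi := iter_closed i lA (WL.2 c _ _ Wf Wg).
have Wc := WL.2 c _ _ Wfi Wgi.
have [WA linA] := lA.
apply/eqP; rewrite eq_le sqrtr_ge0 andbT.
apply: le_trans (norm_trans ipX (g := A (c *: iter i A f + iter i A g)) _ _ _) _.
- exact/WX/WA.
- exact/WX/WA.
- by apply/WX/WL.2; exact: WA.
by rewrite linA// addr0 -IH; exact: nonexpansiveB.
Qed.

Definition op_poly (s : nat) (alpha : nat -> R) (A : V -> V) (v : V) : V :=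
  \sum_(i < s.+1) alpha i *: iter i A v.

Lemma op_poly_linear s alpha A : seminorm_linear A -> nonexpansive A ->
  seminorm_linear (op_poly s alpha A).
Proof.
move=> lA cA; have WP f : W f -> W (op_poly s alpha A f).
  move=> Wf; apply: linear_subspace_sum => // i.
  by apply: linear_subspaceZ => //; exact: iter_closed.
split=> // c f g Wf Wg; rewrite /op_poly scaler_sumr -big_split -sumrB /=.
apply/eqP; rewrite eq_le sqrtr_ge0 andbT.
have WD i : W (iter i A (c *: f + g) - (c *: iter i A f + iter i A g)).
  by apply: linear_subspaceB => //; [|apply: WL.2]; apply: iter_closed => //; exact: WL.2.
have E i : alpha i *: iter i A (c *: f + g)
    - (c *: (alpha i *: iter i A f) + alpha i *: iter i A g)
    = alpha i *: (iter i A (c *: f + g) - (c *: iter i A f + iter i A g)).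
  by rewrite scalerBr scalerDr !scalerA [c * _]mulrC.
under eq_bigr => i _ do rewrite E.
apply: le_trans (norm_sum ipX _) _ => [i|].
  exact/WX/(linear_subspaceZ WL)/WD.
rewrite big1// => i _; rewrite (normZ ipX); last exact/WX/WD.
by rewrite (iter_linear i lA cA).2// mulr0.
Qed.

(** An approximate orbit: the defects of [g] add up instead of being amplified,
   as [A] does not expand distances. *)
Lemma iter_chain A (g : nat -> V) (n : nat) eps : seminorm_linear A -> nonexpansive A ->
  (forall i, (i <= n)%N -> W (g i)) ->
  (forall i, (i < n)%N -> N (A (g i) - g i.+1) <= eps) ->
  forall i, (i <= n)%N -> N (iter i A (g 0%N) - g i) <= i%:R * eps.
Proof.
move=> lA cA Wg gA; elim=> [|i IH] iltn /=.
  by rewrite subrr (norm0 ipX) mul0r.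
have Wgi := Wg _ (ltnW iltn).
have Wi := iter_closed i lA (Wg 0%N isT).
apply: le_trans (norm_trans ipX (g := A (g i)) _ _ _) _.
- exact/WX/lA.1.
- exact/WX/lA.1.
- exact/WX/Wg.
rewrite -natr1 mulrDl mul1r lerD ?gA//.
apply: le_trans (nonexpansiveB lA cA Wi Wgi) _.
exact/IH/ltnW.
Qed.

(** The powers of [A] up to [p] are replaced by the entries of [g].  A power
   beyond [p] has no entry to be compared with, but it is a further iterate of
   the power [p + 1], hence no larger than [g p.+1] up to defects. *)
Lemma op_poly_chain A (g : nat -> V) (s p : nat) alpha eps :
  seminorm_linear A -> nonexpansive A -> (p <= s)%N -> 0 <= eps ->
  (forall i, (i <= p.+1)%N -> W (g i)) ->
  (forall i, (i <= p)%N -> N (A (g i) - g i.+1) <= eps) ->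
  N (op_poly s alpha A (g 0%N) - \sum_(i < p.+1) alpha i *: g i) <=
  (\sum_(i < s.+1) `|alpha i|) * (p.+1%:R * eps + N (g p.+1)).
Proof.
move=> lA cA ps eps0 Wg gA.
(* the powers beyond p are compared with 0 *)
pose G i := if (i <= p)%N then g i else 0.
have -> : \sum_(i < p.+1) alpha i *: g i = \sum_(i < s.+1) alpha i *: G i.
  rewrite (big_ord_widen s.+1 (fun i => alpha i *: g i))//.
  rewrite big_mkcond; apply: eq_bigr => i _; rewrite /G ltnS.
  by case: ifP => // _; rewrite scaler0.
have WG i : W (G i) by rewrite /G; case: ifP => [ilep|_]; [exact/Wg/leqW|exact: WL.1].
have Wi i : W (iter i A (g 0%N)) by apply: iter_closed => //; exact: Wg.
have WD i := linear_subspaceB WL (Wi i) (WG i).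
rewrite /op_poly -sumrB; under eq_bigr => i _ do rewrite -scalerBr.
apply: le_trans (norm_sum ipX _) _ => [i|]; first exact/WX/(linear_subspaceZ WL).
rewrite mulr_suml; apply: ler_sum => i _.
rewrite (normZ ipX); last exact: WX.
apply: ler_wpM2l => //.
have chain := iter_chain lA cA Wg gA.
rewrite /G; case: leqP => [ilep|pi].
  apply: (le_trans (chain _ (leqW ilep))); rewrite -[leLHS]addr0 lerD ?sqrtr_ge0//.
  by rewrite ler_wpM2r// ler_nat leqW.
rewrite subr0 -(subnK pi) iterD.
apply: le_trans (iter_nonexpansive _ lA cA (Wi p.+1)) _.
apply: le_trans (norm_sub_le ipX (WX (Wi p.+1)) (WX (Wg p.+1 (leqnn _)))) _.
by rewrite lerD2r chain.
Qed.

End operators.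

(** * Taylor expansion with one-sided derivatives *)

Section Taylor.
Variable R : realType.

Definition derivative_within_ge0 (f : R -> R) (t l : R) : Prop :=
  (s - t)^-1 * (f s - f t) @[s --> within [set s | 0 <= s] t^'] --> l.

(** Away from time 0 the one-sided derivative is the usual one.  The shift by
   [t] is built in, since the Taylor expansion is in powers of the increment. *)
Lemma derivative_within_is_derive f (t y l : R) : 0 < t + y ->
  derivative_within_ge0 f (t + y) l -> is_derive y 1 (fun z => f (t + z)) l.
Proof.
move=> t0 ft.
have sh : h + (t + y) @[h --> (0 : R)^'] --> within [set s | 0 <= s] (t + y)^'.
  move=> P /nbhs_ballP[e /= e0 eP].
  apply/nbhs_ballP; exists (Num.min e (t + y)); first by rewrite /= lt_min e0.
  move=> h; rewrite /ball /= sub0r normrN lt_min => /andP[he ht] h0.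
  apply: eP => /=.
  - by rewrite /ball /= opprD addrCA subrr addr0 normrN.
  - by rewrite -subr_eq0 addrK.
  - by move: ht; rewrite ltr_norml => /andP[]; lra.
have H : (h^-1 *: (((fun z => f (t + z)) \o shift y) (h *: 1) - f (t + y))
            @[h --> 0^'] --> l).
  rewrite (_ : (fun h : R => h^-1 *: _) =
    (fun s => (s - (t + y))^-1 * (f s - f (t + y))) \o (fun h => h + (t + y))).
    exact: cvg_comp sh ft.
  by apply/funext => h /=; rewrite addrK [h%:A]mulr1 addrCA.
apply: DeriveDef; first by apply/cvg_ex; exists l.
exact: cvg_lim H.
Qed.

(** At time 0 only right continuity survives, which is what the mean value
   theorem asks for at an endpoint. *)
Lemma derivative_within_right_continuous f (t l : R) : 0 <= t ->
  derivative_within_ge0 f t l -> f (t + z) @[z --> 0^'+] --> f t.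
Proof.
move=> t0 ft.
have sh : t + z @[z --> 0^'+] --> within [set s | 0 <= s] t^'.
  move=> P /nbhs_ballP[e /= e0 eP].
  apply/nbhs_ballP; exists e => //= z.
  rewrite /ball /= sub0r normrN => ze z0; apply: eP => /=.
  - by rewrite /ball /= opprD addrA subrr sub0r normrN.
  - by rewrite gt_eqF// ltrDl.
  - exact/addr_ge0/ltW.
have ft' := cvg_comp _ _ sh ft.
have idt : z @[z --> (0 : R)^'+] --> (0 : R) by exact: cvg_within_filter.
have : f t + z * ((t + z - t)^-1 * (f (t + z) - f t)) @[z --> 0^'+]
         --> f t + 0 * l.
  by apply: cvgD; [exact: cvg_cst|exact: cvgM].
rewrite mul0r addr0; apply: cvg_trans; apply: near_eq_cvg.
near=> z; rewrite [t + z - t]addrAC subrr add0r mulrA divff ?mul1r.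
  by rewrite addrC subrK.
by rewrite gt_eqF.
Unshelve. all: by end_near. Qed.

(** Induction on the order by the mean value theorem: the derivative of the
   remainder of order [N + 1] of [phi 0] is the remainder of order [N] of
   [phi 1].  The factorial in the denominator of the sharp bound is given up. *)
Lemma taylor_remainder_le (phi : nat -> R -> R) (N : nat) (K : R) :
  (forall i t, (i < N)%N -> 0 <= t ->
     derivative_within_ge0 (phi i) t (phi i.+1 t)) ->
  (forall t, 0 <= t -> `|phi N t| <= K) ->
  forall t x, 0 <= t -> 0 <= x ->
  `|phi 0%N (t + x) - \sum_(j < N) x ^+ j / (j`!)%:R * phi j t| <= K * x ^+ N.
Proof.
elim: N phi => [|N IH] phi dphi bphi t x t0 x0.
  by rewrite big_ord0 subr0 expr0 mulr1 bphi// addr_ge0.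
pose p := \poly_(j < N.+1) (phi j t / (j`!)%:R).
have pE y : p.[y] = \sum_(j < N.+1) y ^+ j / (j`!)%:R * phi j t.
  rewrite horner_poly; apply: eq_bigr => j _; by ring.
have dpE y : p^`().[y] = \sum_(j < N) y ^+ j / (j`!)%:R * phi j.+1 t.
  have -> : p^`() = \poly_(j < N) (phi j.+1 t / (j`!)%:R).
    apply/polyP => j; rewrite coef_deriv !coef_poly ltnS.
    case: ifP => _; last by rewrite mul0rn.
    rewrite factS natrM -[LHS]mulr_natr invfM -!mulrA.
    by rewrite [_^-1 * _]mulrCA mulVf ?mulr1// pnatr_eq0.
  rewrite horner_poly; apply: eq_bigr => j _; by ring.
pose F y := phi 0%N (t + y) - p.[y].
rewrite -pE -/(F x).
have F0 : F 0 = 0.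
  rewrite /F addr0 pE big_ord_recl expr0 fact0 divr1 mul1r.
  by rewrite big1 ?addr0 ?subrr// => j _; rewrite expr0n mul0r mul0r.
move: x0; rewrite le_eqVlt => /predU1P[<-|x0].
  by rewrite F0 normr0 expr0n mulr0.
have dF (y : R) : 0 < y -> is_derive y 1 F (phi 1%N (t + y) - p^`().[y]).
  move=> y0; apply: is_deriveB; apply: derivative_within_is_derive.
    exact: ltr_wpDl.
  by apply: dphi => //; rewrite addr_ge0// ltW.
have cF : {within `[0, x], continuous F}.
  apply/continuous_within_itvP => //; split.
  - move=> y; rewrite in_itv/= => /andP[y0 _].
    apply: differentiable_continuous; apply/derivable1_diffP.
    exact: (ex_derive (is_derive := dF _ y0)).
  - apply: cvgB.
      by rewrite addr0; apply: derivative_within_right_continuous t0 (dphi 0%N _ _ t0).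
    apply: cvg_at_right_filter; exact: continuous_horner.
  - apply: cvg_at_left_filter.
    apply: differentiable_continuous; apply/derivable1_diffP.
    exact: (ex_derive (is_derive := dF _ x0)).
have dFx y : y \in `]0, x[ -> is_derive y 1 F (phi 1%N (t + y) - p^`().[y]).
  by rewrite in_itv/= => /andP[/dF].
have [c] := MVT_segment (ltW x0) dFx cF.
rewrite F0 !subr0 in_itv/= => /andP[c0 cx] ->.
rewrite normrM (ger0_norm (ltW x0)) exprSr mulrA ler_wpM2r ?(ltW x0)// dpE.
have dphiS i s : (i < N)%N -> 0 <= s ->
  derivative_within_ge0 (phi i.+1) s (phi i.+2 s) by move=> iN; exact: dphi.
apply: le_trans (IH (fun i => phi i.+1) dphiS bphi t c t0 c0) _.
rewrite ler_wpM2l ?lerXn2r//; first exact: le_trans (bphi t t0).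
by rewrite nnegrE ltW.
Qed.
End Taylor.

(** * Local error of the Runge-Kutta step *)

Section local_error.
Variables (R : realType) (V : lmodType R) (X : set V) (ip : V -> V -> R).
Hypothesis ipX : semi_inner X ip.

Local Notation N f := (Num.sqrt (ip f f)).

(** The scalar expansion is applied to the pairings of [P i] with the remainder
   [v]; it bounds [ip v v] by [K * N v * x ^+ n]. *)
Lemma taylor_seminorm (P : nat -> R -> V) (n : nat) (K : R) :
  (forall i t, (i <= n)%N -> 0 <= t -> X (P i t)) ->
  (forall i t, (i < n)%N -> 0 <= t ->
     N ((s - t)^-1 *: (P i s - P i t) - P i.+1 t)
       @[s --> within [set s | 0 <= s] t^'] --> (0 : R)) ->
  (forall t, 0 <= t -> N (P n t) <= K) ->
  forall t x, 0 <= t -> 0 <= x ->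
  N (P 0%N (t + x) - \sum_(j < n) (x ^+ j / (j`!)%:R) *: P j t) <= K * x ^+ n.
Proof.
move=> XP dP bP t x t0 x0.
have XL := semi_inner_closed ipX.
have tx0 : 0 <= t + x by rewrite addr_ge0.
have XZ (j : 'I_n) : X ((x ^+ j / (j`!)%:R) *: P j t).
  by apply: linear_subspaceZ => //; apply: XP => //; exact: ltnW.
set v := _ - _.
have Xv : X v.
  by apply: linear_subspaceB => //; [exact: XP|exact: linear_subspace_sum].
have K0 : 0 <= K := le_trans (sqrtr_ge0 _) (bP t t0).
pose phi i (s : R) := ip (P i s) v.
have dphi i (s : R) : (i < n)%N -> 0 <= s ->
    derivative_within_ge0 (phi i) s (phi i.+1 s).
  move=> iltn s0; apply/cvgrPdist_le => e e0.
  have e' : 0 < e / (N v + 1) by rewrite divr_gt0// ltr_wpDl ?sqrtr_ge0.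
  have small := (cvgrPdist_le _ _).1 (dP i s iltn s0) _ e'.
  have FF : Filter (within [set s : R | 0 <= s] s^') by exact: within_filter.
  have wT := @withinT _ (s^') [set s : R | 0 <= s] _.
  apply: (@filterS2 _ _ FF _ _ _ _ (small FF) (wT _)) => y /= close y0.
  have Xi := XP i _ (ltnW iltn).
  have XPy := Xi y y0; have XPs := Xi s s0.
  have XPs' := XP i.+1 s iltn s0.
  have XD := linear_subspaceB XL XPy XPs.
  have XQ := linear_subspaceZ XL (y - s)^-1 XD.
  have -> : phi i.+1 s - (y - s)^-1 * (phi i y - phi i s) =
      - ip ((y - s)^-1 *: (P i y - P i s) - P i.+1 s) v.
    by rewrite /phi (ipBl ipX)// (ipZl ipX)// (ipBl ipX)// opprB.
  rewrite normrN; apply: le_trans (cauchy_schwarz ipX _ Xv) _.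
    exact: linear_subspaceB.
  have : N ((y - s)^-1 *: (P i y - P i s) - P i.+1 s) <= e / (N v + 1).
    by move: close; rewrite sub0r normrN ger0_norm ?sqrtr_ge0.
  move=> Hle; apply: le_trans (ler_wpM2r (sqrtr_ge0 _) Hle) _.
  rewrite mulrAC ler_pdivrMr ?ltr_wpDl ?sqrtr_ge0//.
  by rewrite ler_wpM2l ?lerDl// ltW.
have bphi s : 0 <= s -> `|phi n s| <= K * N v.
  move=> s0; apply: le_trans (cauchy_schwarz ipX (XP n s (leqnn _) s0) Xv) _.
  by rewrite ler_wpM2r ?sqrtr_ge0 ?bP.
have := taylor_remainder_le dphi bphi t0 x0.
have -> : phi 0%N (t + x) - \sum_(j < n) x ^+ j / (j`!)%:R * phi j t = ip v v.
  rewrite {2}/v (ipBl ipX) ?(ip_suml ipX)//; first last.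
  - exact: linear_subspace_sum.
  - exact: XP.
  congr (_ - _); apply: eq_bigr => j _.
  by rewrite (ipZl ipX)//; apply: XP => //; exact: ltnW.
move=> H; apply: (norm_le_dual ipX).
  by rewrite mulr_ge0 ?exprn_ge0.
by rewrite mulrAC (le_trans (ler_norm _)).
Qed.

Variable W : set V.
Hypotheses (WL : linear_subspace W) (WX : W `<=` X).

Lemma seminorm_linear_scale B tau :
  seminorm_linear ip W B -> seminorm_linear ip W (fun w => tau *: B w).
Proof.
move=> [WB linB]; split=> [f Wf|c f g Wf Wg].
  by apply: linear_subspaceZ => //; exact: WB.
rewrite scalerA mulrC -scalerA -scalerDr -scalerBr (normZ ipX) ?linB ?mulr0//.
apply/WX/(linear_subspaceB WL); first by apply/WB/WL.2.
by apply: WL.2; exact: WB.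
Qed.

(** Both terms are compared with the Taylor polynomial of [P 0], whose
   coefficients are the [alpha i] by accuracy.  The hypothesis [tau <= 1] serves
   to keep a single factor [tau] in each defect [tau ^+ i.+1 * delta]. *)
Lemma rk_local_error (B : V -> V) (P : nat -> R -> V) (s p : nat)
    (alpha : nat -> R) (tau K delta t : R) :
  seminorm_linear ip W B ->
  0 <= tau <= 1 -> nonexpansive ip W (fun w => tau *: B w) ->
  (p <= s)%N -> (forall i, (i <= p)%N -> alpha i = (i`!)%:R^-1) ->
  (forall i t, (i <= p.+1)%N -> 0 <= t -> W (P i t)) ->
  (forall i t, (i <= p)%N -> 0 <= t ->
     N ((s - t)^-1 *: (P i s - P i t) - P i.+1 t)
       @[s --> within [set s | 0 <= s] t^'] --> (0 : R)) ->
  (forall t, 0 <= t -> N (P p.+1 t) <= K) ->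
  (forall i, (i <= p)%N -> N (B (P i t) - P i.+1 t) <= delta) ->
  0 <= t ->
  N (P 0%N (t + tau) - op_poly s alpha (fun w => tau *: B w) (P 0%N t)) <=
  (1 + \sum_(i < s.+1) `|alpha i|) *
    (p.+1%:R * (tau * delta) + K * tau ^+ p.+1).
Proof.
move=> lB /andP[tau0 tau1] cA ps alphaE WP dP bP BP t0.
have lA := seminorm_linear_scale tau lB.
set A := (fun w => _) in lA cA *.
pose g i := tau ^+ i *: P i t.
have Wg i : (i <= p.+1)%N -> W (g i).
  by move=> ip'; apply: linear_subspaceZ => //; exact: WP.
have d0 : 0 <= delta := le_trans (sqrtr_ge0 _) (BP 0%N isT).
have gA i : (i <= p)%N -> N (A (g i) - g i.+1) <= tau * delta.
  move=> ilep; have WPi := WP i t (leqW ilep) t0; have WPi1 := WP i.+1 t ilep t0.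
  have Wgi := Wg i (leqW ilep); have Wgi1 := Wg i.+1 ilep.
  have WAg := linear_subspaceZ WL (tau ^+ i) (lA.1 _ WPi).
  apply: le_trans (norm_trans ipX (g := tau ^+ i *: A (P i t)) _ _ _) _.
  - exact/WX/lA.1.
  - exact: WX.
  - exact: WX.
  rewrite (seminorm_linearZ ipX WL WX _ lA WPi) add0r.
  rewrite /g /A scalerA -exprSr -scalerBr (normZ ipX); last first.
    by apply/WX/(linear_subspaceB WL) => //; apply: lB.1.
  rewrite ger0_norm ?exprn_ge0// ler_pM ?exprn_ge0 ?sqrtr_ge0 ?BP//.
  by rewrite exprS ler_piMr// exprn_ile1.
have gE : \sum_(j < p.+1) (tau ^+ j / (j`!)%:R) *: P j t =
          \sum_(j < p.+1) alpha j *: g j.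
  apply: eq_bigr => j _; rewrite /g scalerA alphaE 1?mulrC//.
  by rewrite -ltnS.
have WS : W (\sum_(j < p.+1) alpha j *: g j).
  apply: linear_subspace_sum => // j; apply: linear_subspaceZ => //; apply: Wg.
  exact: ltnW.
have g0 : g 0%N = P 0%N t by rewrite /g expr0 scale1r.
have WP0 := WP 0%N t isT t0.
apply: le_trans (norm_trans ipX (g := \sum_(j < p.+1) alpha j *: g j) _ _ _) _.
- by apply/WX/WP => //; rewrite addr_ge0.
- exact: WX.
- exact/WX/(op_poly_linear ipX WL WX s alpha lA cA).1.
rewrite mulrDl mul1r lerD//.
  rewrite -gE -[leLHS]add0r lerD ?mulr_ge0//.
  by apply: taylor_seminorm => // i y ilep y0; exact/WX/WP.
rewrite (normB ipX); last 2 first.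
- exact: WX.
- exact/WX/(op_poly_linear ipX WL WX s alpha lA cA).1.
rewrite -g0.
apply: le_trans (op_poly_chain ipX WL WX alpha lA cA ps _ Wg gA) _.
  exact: mulr_ge0.
rewrite ler_wpM2l ?sumr_ge0// lerD2l (normZ ipX); last exact/WX/WP.
by rewrite ger0_norm ?exprn_ge0// mulrC ler_wpM2r ?exprn_ge0 ?bP.
Qed.

End local_error.

(** * Accumulation of the local errors *)

Section gronwall.
Variable R : realType.
Implicit Types mu tau t : R.

Lemma sigma_ge0 mu t : 0 <= mu -> 0 <= t -> 0 <= sigma mu t.
Proof.
move=> mu0 t0; rewrite /sigma; case: ifP => // _.
by rewrite divr_ge0// subr_ge0 -expR0 ler_expR mulr_ge0.
Qed.

Lemma expR_step mu tau t : (1 + mu * tau) * expR (mu * t) <= expR (mu * (t + tau)).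
Proof.
rewrite mulrDr [mu * t + _]addrC expRD ler_wpM2r ?expR_ge0//.
exact: expR_ge1Dx.
Qed.

(** [sigma mu] is a supersolution of the recursion
   [x_(n+1) = (1 + mu tau) x_n + tau], because [1 + mu tau <= expR (mu tau)]. *)
Lemma sigma_step mu tau t : 0 <= mu ->
  (1 + mu * tau) * sigma mu t + tau <= sigma mu (t + tau).
Proof.
rewrite /sigma le_eqVlt eq_sym; case: eqVneq => [->|mu_neq0] /= mu0.
  by rewrite mul0r addr0 mul1r.
rewrite ler_pdivlMr//.
have -> : ((1 + mu * tau) * ((expR (mu * t) - 1) / mu) + tau) * mu =
  (1 + mu * tau) * expR (mu * t) - 1 by field.
by rewrite lerD2r expR_step.
Qed.

Lemma discrete_gronwall (e : nat -> R) mu tau delta :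
  0 <= mu -> 0 <= tau -> 0 <= delta -> 0 <= e 0%N ->
  (forall n, e n.+1 <= (1 + mu * tau) * e n + tau * delta) ->
  forall n, e n <=
    expR (mu * (n%:R * tau)) * e 0%N + sigma mu (n%:R * tau) * delta.
Proof.
move=> mu0 tau0 d0 e0 estep; elim=> [|n IH].
  rewrite mul0r mulr0 expR0 mul1r lerDl mulr_ge0//.
  exact: sigma_ge0.
have mt0 : 0 <= 1 + mu * tau by rewrite addr_ge0 ?mulr_ge0.
apply: le_trans (estep n) _.
have -> : n.+1%:R * tau = n%:R * tau + tau by rewrite -natr1 mulrDl mul1r.
have := ler_wpM2l mt0 IH.
have := ler_wpM2r e0 (expR_step mu tau (n%:R * tau)).
have := ler_wpM2r d0 (sigma_step tau (n%:R * tau) mu0).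
set E := expR (mu * _); set E' := expR _; set S := sigma _ _; set S' := sigma _ _.
move: (e n) (e 0%N) => x y; move=> *; nra.
Qed.

End gronwall.

(** * The semidefinite space L^2 *)

Section L2_structure.
Variables (R : realType) (d m : nat) (Omega : set 'rV[R]_d).
Hypothesis Omega_open : open Omega.
Local Notation fn := ('rV[R]_d -> 'cV[R]_m).
Local Notation leb := (lebesgue_rV R d).
Local Notation D := (Omega : set (borel_rV R d)).

Lemma measurable_open_rV : measurable D.
Proof. exact: sub_sigma_algebra. Qed.

Lemma measurable_coord (f : fn) (j : 'I_m) : L2 Omega f ->
  measurable_fun D (fun x : borel_rV R d => f (x : 'rV[R]_d) j 0).
Proof. by move=> /(_ j)[]. Qed.

Lemma integrable_sqr (f : fn) (j : 'I_m) : L2 Omega f ->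
  leb.-integrable D (EFin \o (fun x : borel_rV R d => f (x : 'rV[R]_d) j 0 ^+ 2)).
Proof.
move=> /(_ j)[mf If]; apply/integrableP; split.
  by apply/measurable_EFinP; exact: measurable_funX.
by under eq_integral => x _ do rewrite /= ger0_norm ?sqr_ge0//.
Qed.

(** The product of two square integrable functions is dominated by the sum of
   their squares. *)
Lemma integrable_prod (f g : fn) (j : 'I_m) : L2 Omega f -> L2 Omega g ->
  leb.-integrable D
    (EFin \o (fun x : borel_rV R d => f (x : 'rV[R]_d) j 0 * g (x : 'rV[R]_d) j 0)).
Proof.
move=> Lf Lg; apply: (le_integrable measurable_open_rV _ _
  (integrableD measurable_open_rV (integrable_sqr j Lf) (integrable_sqr j Lg))).
  by apply/measurable_EFinP; apply: measurable_funM; exact: measurable_coord.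
move=> x _ /=; rewrite lee_fin [leRHS]ger0_norm ?addr_ge0 ?sqr_ge0//.
move: (f x j 0) (g x j 0) => y z; rewrite ler_norml.
have := sqr_ge0 (y + z); have := sqr_ge0 (y - z).
have := sqr_ge0 y; have := sqr_ge0 z.
by move=> *; apply/andP; split; nra.
Qed.

Lemma integrable_inner (f g : fn) : L2 Omega f -> L2 Omega g ->
  leb.-integrable D (EFin \o (fun x : borel_rV R d =>
     \sum_(j < m) f (x : 'rV[R]_d) j 0 * g (x : 'rV[R]_d) j 0)).
Proof.
move=> Lf Lg.
rewrite (_ : _ \o _ = fun x : borel_rV R d =>
   (\sum_(j < m) (f (x : 'rV[R]_d) j 0 * g (x : 'rV[R]_d) j 0)%:E)%E).
  apply: integrable_sum => [|j _]; first exact: measurable_open_rV.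
  exact: integrable_prod.
by apply/funext => x /=; rewrite sumEFin.
Qed.

Lemma L2_linear (c : R) (f g : fn) :
  L2 Omega f -> L2 Omega g -> L2 Omega (c *: f + g).
Proof.
move=> Lf Lg j; split.
  rewrite (_ : (fun x => _) = (fun x : borel_rV R d =>
     c * f (x : 'rV[R]_d) j 0 + g (x : 'rV[R]_d) j 0)); last first.
    by apply/funext => x; rewrite !mxE.
  apply: measurable_funD; last exact: measurable_coord.
  by apply: measurable_funM => //; exact: measurable_coord.
have I2 := integrableD measurable_open_rV
  (integrableZl measurable_open_rV (2 * c ^+ 2) (integrable_sqr j Lf))
  (integrableZl measurable_open_rV 2 (integrable_sqr j Lg)).
case/integrableP: I2 => mI2 I2y.
apply: le_lt_trans I2y.
apply: ge0_le_integral => //.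
- exact: measurable_open_rV.
- by move=> x _; rewrite lee_fin sqr_ge0.
- apply/measurable_EFinP/measurable_funX.
  rewrite (_ : (fun x => _) = (fun x : borel_rV R d =>
     c * f (x : 'rV[R]_d) j 0 + g (x : 'rV[R]_d) j 0)); last first.
    by apply/funext => x; rewrite !mxE.
  apply: measurable_funD; last exact: measurable_coord.
  by apply: measurable_funM => //; exact: measurable_coord.
- exact: measurableT_comp mI2.
- move=> x _; rewrite lee_fin !mxE; apply: le_trans (ler_norm _).
  by have := sqr_ge0 (c * f x j 0 - g x j 0); nra.
Qed.

Lemma L2_zero : L2 Omega (0 : fn).
Proof.
move=> j; split.
  by rewrite (_ : (fun x => _) = cst 0)//; apply/funext => x; rewrite mxE.
rewrite integral0_eq// => x _; by rewrite mxE expr0n.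
Qed.

Lemma innerC (f g : fn) : inner Omega f g = inner Omega g f.
Proof.
by apply: eq_Rintegral => x _; apply: eq_bigr => j _; rewrite mulrC.
Qed.

Lemma inner_linear (c : R) (f g h : fn) :
  L2 Omega f -> L2 Omega g -> L2 Omega h ->
  inner Omega (c *: f + g) h = c * inner Omega f h + inner Omega g h.
Proof.
move=> Lf Lg Lh; rewrite /inner -RintegralZl//; first last.
- exact: integrable_inner.
- exact: measurable_open_rV.
rewrite -RintegralD//; first last.
- exact: integrable_inner.
- rewrite (_ : _ \o _ = fun x : borel_rV R d => (c%:E *
     (\sum_(j < m) f (x : 'rV[R]_d) j 0 * h (x : 'rV[R]_d) j 0)%:E)%E)//.
  by apply: integrableZl; [exact: measurable_open_rV|exact: integrable_inner].
- exact: measurable_open_rV.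
apply: eq_Rintegral => x _; rewrite mulr_sumr -big_split/=.
by apply: eq_bigr => j _; rewrite !mxE mulrDl mulrA.
Qed.

Lemma inner_ge0 (f : fn) : 0 <= inner Omega f f.
Proof.
by apply: Rintegral_ge0 => x _; apply: sumr_ge0 => j _; rewrite -expr2 sqr_ge0.
Qed.

(** Equality almost everywhere enters the norm estimates through this lemma
   alone. *)
Lemma l2norm_ae0 (f g : fn) : L2 Omega f -> L2 Omega g ->
  f = g %[ae leb in Omega] -> l2norm Omega (f - g) = 0.
Proof.
move=> Lf Lg fg.
have Lfg : L2 Omega (f - g) by rewrite -scaleN1r addrC; exact: L2_linear.
suff : inner Omega (f - g) (f - g) = 0 by rewrite /l2norm => ->; rewrite sqrtr0.
rewrite /inner /Rintegral (@ae_eq_integral _ _ _ leb D (cst 0%E)).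
- by rewrite integral0.
- exact: measurable_open_rV.
- by case/integrableP: (integrable_inner Lfg Lfg).
- exact: measurable_cst.
- apply: (@filterS _ _ (ae_filter_ringOfSetsType leb) _ _ _ fg) => x /[apply] fgx; congr EFin.
  by apply: big1 => j _; rewrite !mxE fgx subrr mul0r.
Qed.

Lemma L2_semi_inner : semi_inner (@L2 R d m Omega) (inner Omega).
Proof.
split.
- by split; [exact: L2_zero|move=> *; exact: L2_linear].
- exact: innerC.
- by move=> *; exact: inner_linear.
- exact: inner_ge0.
Qed.

Lemma subspace_linear (W : set fn) : Defs.subspace Omega W -> linear_subspace W.
Proof. by move=> [_ W0 WZ]. Qed.

Lemma linear_on_seminorm (W : set fn) A : linear_on Omega W A ->
  (forall v, W v -> W (A v)) -> seminorm_linear (inner Omega) W A.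
Proof.
move=> [Wsub _ linA] WA; split=> // c f g Wf Wg.
have [WX W0 WZ] := Wsub.
apply: l2norm_ae0; last exact: linA.
- exact/WX/WA/WZ.
- by apply/WX/WZ; exact: WA.
Qed.

Lemma opnorm_le (W : set fn) A C : (opnorm Omega W A <= C%:E)%E ->
  forall v, W v -> l2norm Omega v <= 1 -> l2norm Omega (A v) <= C.
Proof.
move=> opA v Wv v1; rewrite -lee_fin; apply: le_trans opA.
by apply: ereal_sup_ubound; exists v.
Qed.

Lemma admissible_nonexpansive (W : set fn) A (tau c : R) :
  Defs.subspace Omega W -> seminorm_linear (inner Omega) W A ->
  0 < tau -> c < 1 -> (tau%:E * opnorm Omega W A <= c%:E)%E ->
  nonexpansive (inner Omega) W (fun w => tau *: A w).
Proof.
move=> Wsub lA tau0 c1 tauA v Wv; have [WX W0 WZ] := Wsub.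
have WL := subspace_linear Wsub.
have lB := seminorm_linear_scale L2_semi_inner WL WX tau lA.
rewrite -[leRHS]mul1r; apply: (ball_bounded L2_semi_inner WL WX lB) => // w Ww w1.
rewrite (normZ L2_semi_inner); last exact/WX/lA.1.
rewrite gtr0_norm//; apply: le_trans (ltW c1).
rewrite -lee_fin; apply: le_trans tauA; rewrite EFinM.
apply: lee_wpmul2l; first by rewrite lee_fin ltW.
by apply: ereal_sup_ubound; exists w.
Qed.

(** The term of the Sobolev norm with the zero multi-index is the L^2 norm. *)
Lemma l2norm_le_sobolev r (w : fn) : l2norm Omega w <= sobolev_norm Omega r w.
Proof.
rewrite /sobolev_norm; pose al : multi_index d r := [ffun=> ord0].
have al0 : mi_order al = 0%N by rewrite /mi_order big1// => i _; rewrite ffunE.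
have alw : Dmi al w = w.
  rewrite /Dmi (_ : flatten _ = [::])//.
  elim: (enum _) => //= i e ->; by rewrite ffunE.
rewrite (bigD1 al) ?al0//= alw.
rewrite -[leLHS]ger0_norm ?sqrtr_ge0// -sqrtr_sqr ler_wsqrtr// lerDl.
by apply: sumr_ge0 => *; exact: sqr_ge0.
Qed.

End L2_structure.

(** * The error estimate *)

(** [b], [a1], [a2], [a3] stand for [p + 1] and the three quantities of which the
   constant is made, [e] for [h^(k+k')] and [x] for [tau^p]; the bound
   [x <= 1] absorbs the mixed product [e * x]. *)
Lemma absorb_local_error (R : realType) (b a1 a2 a3 e x tau : R) :
  0 <= b -> 0 <= a1 -> 0 <= a2 -> 0 <= a3 -> 0 <= e -> 0 <= x -> x <= 1 ->
  0 <= tau ->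
  b * (tau * ((a1 + a2) * e)) + (a1 * e + a3) * (tau * x) <=
  (b + 1) * (a1 + a2 + a3) * (tau * (e + x)).
Proof.
move=> b0 a10 a20 a30 e0 x0 x1 tau0.
have H : b * ((a1 + a2) * e) + (a1 * e + a3) * x <=
         (b + 1) * (a1 + a2 + a3) * (e + x).
  have Q0 : 0 <= a1 + a2 + a3 by rewrite !addr_ge0.
  have := mulr_ge0 b0 (mulr_ge0 a30 e0).
  have : 0 <= a1 * e * (1 - x) by rewrite !mulr_ge0// subr_ge0.
  have := mulr_ge0 a20 e0; have := mulr_ge0 a30 e0.
  have := mulr_ge0 b0 (mulr_ge0 Q0 x0).
  have := mulr_ge0 a10 x0; have := mulr_ge0 a20 x0.
  lra.
have := ler_wpM2l tau0 H; lra.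
Qed.

Unset Implicit Arguments.

Theorem corollary3p1 (R : realType) (d m q r : nat) (Omega : set 'rV[R]_d)
    (a : multi_index d q -> 'rV[R]_d -> 'M[R]_m)
    (bc : set ('rV[R]_d -> 'cV[R]_m))
    (Vh : R -> set ('rV[R]_d -> 'cV[R]_m))
    (Lh : R -> ('rV[R]_d -> 'cV[R]_m) -> ('rV[R]_d -> 'cV[R]_m))
    (DPi : R -> set ('rV[R]_d -> 'cV[R]_m))
    (Pi : R -> ('rV[R]_d -> 'cV[R]_m) -> ('rV[R]_d -> 'cV[R]_m))
    (k k' : R) (CT CS : R -> R)
    (Omega_open : open Omega)
    (L_order : exact_order Omega a)
    (q_le_r : (q <= r)%N)
    (Vh_subspace : forall h, 0 < h <= 1 -> finite_dim_subspace Omega (Vh h))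
    (Lh_linear : forall h, 0 < h <= 1 -> linear_on Omega (Vh h) (Lh h))
    (Lh_range : forall h v, 0 < h <= 1 -> Vh h v -> Vh h (Lh h v))
    (k'_range : 0 <= k' <= 1)
    (CT_mono : {homo CT : x y / x <= y}) (CS_mono : {homo CS : x y / x <= y})
    (condition2 : consistent Omega r a bc k k' CT CS Vh Lh DPi Pi)
    (s p : nat) (alpha : nat -> R)
    (p_ge1 : (1 <= p)%N) (accurate : rk_accurate s p alpha) :
  exists CE : R -> R,
    forall (lambda c : R) (mu : R -> R),
      0 < lambda -> c < 1 -> (forall h, 0 <= mu h) ->
      rk_stable Omega q s alpha lambda c Vh Lh mu ->
    forall (u : 'rV[R]_d -> R -> 'cV[R]_m) (M : R),
      solution Omega a u ->
      smooth_solution Omega r p a bc Vh DPi Pi M u ->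
    forall (h tau : R) (uh : nat -> 'rV[R]_d -> 'cV[R]_m) (n : nat),
      admissible Omega q lambda c Vh Lh h tau ->
      discrete_solution Omega (Vh h) (rk_op s alpha tau (Lh h)) uh ->
      let t := n%:R * tau in
      l2norm Omega (u ^~ t - uh n) <=
        expR (mu h * t) * l2norm Omega (Pi h (u ^~ 0) - uh 0%N)
        + CE M * (sigma (mu h) t + 1) * (h `^ (k + k') + tau ^+ p).
Proof.
(* The factor p + 2 counts the p + 1 consistency defects of one step and its
   term of size tau^(p+1); the sum over the alpha i comes from the scheme and
   the 1 from the Taylor remainder. *)
exists (fun M => (1 + \sum_(i < s.+1) `|alpha i|) *
  (p.+2%:R * (`|CT M| + `|CS M| + `|M|))).
move=> lambda c mu _ c1 mu0 stable u M sol smooth h tau uh n adm disc.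
cbv zeta; set t := n%:R * tau.
have [h01 /andP[tau0 tau1] tauLh _] := adm.
have [[Vsub _] linL] := (Vh_subspace h h01, Lh_linear h h01).
have [VX V0 VZ] := Vsub; have VL := subspace_linear Vsub.
have ipX := @L2_semi_inner R d m Omega Omega_open.
have lL := linear_on_seminorm Omega_open linL (fun v => Lh_range h v h01).
have cA := admissible_nonexpansive Omega_open Vsub lL tau0 c1 tauLh.
have lA := seminorm_linear_scale ipX VL VX tau lL.
pose W i t := iter i (diff_op a) (u ^~ t).
pose P i t := Pi h (dt i u ^~ t).
pose eta := h `^ (k + k').
have eta0 : 0 <= eta by exact: powR_ge0.
(* On Omega the time derivatives are iterates of the differential operator,
   but off Omega they may differ: the smoothness hypotheses concern W, the time
   regularity concerns P, and PWae identifies the projections. *)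
have dtW i x y : (i <= p.+1)%N -> Omega x -> 0 <= y -> dt i u x y = W i y x.
  case: i => [|i] // ile Ox y0; exact: (dt_L smooth).
have DW i y : (i <= p.+1)%N -> 0 <= y -> DPi h (W i y).
  by move=> ile y0; apply: (Pi_smooth condition2) => //; exact: (L_smooth smooth).
have Ddt i y : (i <= p.+1)%N -> 0 <= y -> DPi h (dt i u ^~ y).
  by move=> ile y0; have [b /(_ i y ile y0)[]] := Pi_dt_bounded smooth h01.
have VP i y : (i <= p.+1)%N -> 0 <= y -> Vh h (P i y).
  by move=> ile y0; apply: (Pi_range condition2) => //; exact: Ddt.
have VPW i y : (i <= p.+1)%N -> 0 <= y -> Vh h (Pi h (W i y)).
  by move=> ile y0; apply: (Pi_range condition2) => //; exact: DW.
have linPi := Pi_linear condition2 h01.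
have XW i y : (i <= p.+1)%N -> 0 <= y -> L2 Omega (W i y).
  by move=> ile y0; case: linPi => -[DX _ _] _ _; apply/DX/DW.
have PWae i y : (i <= p.+1)%N -> 0 <= y ->
    Pi h (W i y) = P i y %[ae lebesgue_rV R d in Omega].
  move=> ile y0; case: linPi => _ Pae _; apply: Pae; [exact: DW|exact: Ddt|].
  by apply: aeW => x Ox; rewrite dtW.
have sobW i y : (i <= p.+1)%N -> 0 <= y -> sobolev_norm Omega r (W i y) <= M.
  by move=> ile y0; exact: (L_sobolev smooth).
have approx i y : (i <= p.+1)%N -> 0 <= y ->
    l2norm Omega (W i y - P i y) <= `|CT M| * eta.
  move=> ile y0; have XWi := XW i y ile y0.
  have XPi := VX _ (VP i y ile y0); have XPW := VX _ (VPW i y ile y0).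
  apply: le_trans (norm_trans ipX XWi XPW XPi) _.
  rewrite [X in _ + X](l2norm_ae0 Omega_open XPW XPi (PWae i y ile y0)) addr0.
  apply: le_trans (Defs.approximation condition2 h01 (L_smooth smooth ile y0)) _.
  (* the weaker power is enough, and available since h <= 1 and k' <= 1 *)
  have hk : 0 <= h `^ (k + 1) by exact: powR_ge0.
  apply: (@le_trans _ _ (`|CT M| * h `^ (k + 1))).
    by rewrite ler_wpM2r// (le_trans (CT_mono _ _ (sobW i y ile y0)))// ler_norm.
  by rewrite ler_wpM2l// ger_powR// lerD2l; case/andP: k'_range.
have commut i y : (i <= p)%N -> 0 <= y ->
    l2norm Omega (Lh h (P i y) - P i.+1 y) <= (`|CT M| + `|CS M|) * eta.
  move=> ile y0; have ile1 := leqW ile.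
  have VPi := VP i y ile1 y0; have VPWi := VPW i y ile1 y0.
  have VP1 := VP i.+1 y ile y0.
  have VLP := Lh_range h _ h01 VPi; have VLPW := Lh_range h _ h01 VPWi.
  have XW1 := XW i.+1 y ile y0.
  have XP1 := VX _ VP1; have XLP := VX _ VLP; have XLPW := VX _ VLPW.
  rewrite mulrDl.
  apply: (intertwining_error ipX XW1 XP1 XLP XLPW); rewrite ?mulr_ge0//.
  - exact: approx.
  - apply: (l2norm_ae0 Omega_open XLPW XLP).
    by case: linL => _ Lae _; apply: Lae => //; exact: PWae.
  - have Vz := linear_subspaceB VL VP1 VLP.
    apply: le_trans (consistency condition2 h01 (L_smooth smooth ile1 y0) Vz) _.
    rewrite ler_wpM2r ?sqrtr_ge0// ler_wpM2r//.
    by rewrite (le_trans (CS_mono _ _ (sobW i y ile1 y0)))// ler_norm.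
(* Using the bound of the projections given with the smoothness of u would make
   the constant depend on h. *)
have bP y : 0 <= y -> l2norm Omega (P p.+1 y) <= `|CT M| * eta + `|M|.
  move=> y0; have XW1 := XW p.+1 y (leqnn _) y0.
  have XP1 := VX _ (VP p.+1 y (leqnn _) y0).
  apply: le_trans (norm_sub_le ipX XP1 XW1) _.
  rewrite (normB ipX XP1 XW1) lerD//; first exact: approx.
  apply: le_trans (l2norm_le_sobolev Omega r (W p.+1 y)) _.
  by rewrite (le_trans (sobW _ _ (leqnn _) y0))// ler_norm.
have [alpha_gt alphaE _] := accurate.
(* alpha p = 1 / p! is nonzero, whereas the coefficients beyond s vanish. *)
have ps : (p <= s)%N.
  rewrite leqNgt; apply/negP => /alpha_gt; rewrite alphaE// => /eqP.
  by rewrite invr_eq0 pnatr_eq0 eqn0Ngt fact_gt0.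
pose K := (1 + \sum_(i < s.+1) `|alpha i|) *
  (p.+2%:R * (`|CT M| + `|CS M| + `|M|)).
have local_err y : 0 <= y -> l2norm Omega
    (P 0%N (y + tau) - rk_op s alpha tau (Lh h) (P 0%N y)) <=
    tau * (K * (eta + tau ^+ p)).
  move=> y0; have tau01 : 0 <= tau <= 1 by rewrite ltW.
  have := rk_local_error ipX VL VX lL tau01 cA ps alphaE VP
    (fun i y ile y0 => Pi_derivative smooth h01 ile y0) bP
    (fun i ile => commut i y ile y0) y0.
  move=> le; apply: le_trans le _.
  rewrite /K [leRHS]mulrCA -mulrA ler_wpM2l ?addr_ge0 ?sumr_ge0//.
  by rewrite exprS -[p.+2%:R]natr1 absorb_local_error// ?exprn_ge0 ?exprn_ile1// ltW.
pose S := \sum_(i < s.+1) `|alpha i|.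
have S0 : 0 <= S by exact: sumr_ge0.
pose Q := `|CT M| + `|CS M| + `|M|.
have Q0 : 0 <= Q by rewrite !addr_ge0.
have K0 : 0 <= K by rewrite !mulr_ge0// addr_ge0.
have delta0 : 0 <= K * (eta + tau ^+ p).
  by rewrite mulr_ge0 ?addr_ge0 ?exprn_ge0// ltW.
have [Vuh uhS] := disc.
have lR := op_poly_linear ipX VL VX s alpha lA cA.
have bR v : Vh h v ->
    l2norm Omega (rk_op s alpha tau (Lh h) v) <= (1 + mu h * tau) * l2norm Omega v.
  exact: (ball_bounded ipX VL VX lR (opnorm_le (stable h tau adm))).
have tn0 j : 0 <= j%:R * tau by apply: mulr_ge0 => //; exact: ltW.
pose e j := l2norm Omega (P 0%N (j%:R * tau) - uh j).
have estep j : e j.+1 <= (1 + mu h * tau) * e j + tau * (K * (eta + tau ^+ p)).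
  have VPj := VP 0%N _ isT (tn0 j); have VPj1 := VP 0%N _ isT (tn0 j.+1).
  have VRP := lR.1 _ VPj; have VRu := lR.1 _ (Vuh j).
  rewrite addrC /e.
  apply: le_trans (norm_trans ipX (VX _ VPj1) (VX _ VRP) (VX _ (Vuh j.+1))) _.
  rewrite lerD//.
    by rewrite -natr1 mulrDl mul1r; exact: local_err.
  apply: le_trans (norm_trans ipX (VX _ VRP) (VX _ VRu) (VX _ (Vuh j.+1))) _.
  rewrite -[leRHS]addr0 lerD//.
    rewrite (seminorm_linearB ipX VL VX lR VPj (Vuh j)).
    by apply: bR; exact: (linear_subspaceB VL).
  rewrite [leLHS](normB ipX (VX _ VRu) (VX _ (Vuh j.+1))).
  by rewrite [leLHS](l2norm_ae0 Omega_open (VX _ (Vuh j.+1)) (VX _ VRu)).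
have := discrete_gronwall (mu0 h) (ltW tau0) delta0 (sqrtr_ge0 _ : 0 <= e 0%N) estep n.
have XP0 := VX _ (VP 0%N _ isT (tn0 n)).
move=> gron; apply: le_trans (norm_trans ipX (XW 0%N _ isT (tn0 n)) XP0 (VX _ (Vuh n))) _.
have := lerD (approx 0%N _ isT (tn0 n)) gron.
move=> H; apply: le_trans H _.
have CTK : `|CT M| * eta <= K * (eta + tau ^+ p).
  rewrite ler_pM// ?lerDl ?exprn_ge0 ?(ltW tau0)//.
  have CTQ : `|CT M| <= Q by rewrite /Q -addrA lerDl addr_ge0.
  apply: (le_trans CTQ); rewrite /K -/S -/Q mulrA ler_peMl//.
  by rewrite -[leLHS]mul1r ler_pM ?ler1n ?lerDl.
have sig0 := sigma_ge0 (mu0 h) (tn0 n).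
rewrite /e mul0r -/t addrCA lerD2l -/K -/eta.
have -> : K * (sigma (mu h) t + 1) * (eta + tau ^+ p) =
    K * (eta + tau ^+ p) + sigma (mu h) t * (K * (eta + tau ^+ p)) by ring.
exact: lerD.
Qed.
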